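(* Let $N\ge 1$ and suppose that $[2N]=\{1,\dots,2N\}$ is divided into $k$ non-empty intervals $S_1,\dots,S_k$. Let $\sigma$ be a non-crossing partition of $[2N]$ into pairs that does not connect elements of a same subinterval $S_i$. Then there are at most $4^{k-2}$ non-crossing partitions $\pi$ of $[2N]$ (with blocks of even size) that do not connect elements of a same subinterval $S_i$ and such that $Q(\pi)=\sigma$. Moreover, for such a $\pi$ there are at most $2k-4$ elements $i\in[2N]$ for which the block $\pi(i)$ of $\pi$ containing $i$ is not a pair.
   Context: Intervals are sets of consecutive integers for the usual order on $\{1,\dots,2N\}$. A partition ''does not connect elements of a same subinterval $S_i$'' if no two distinct elements of the same $S_i$ lie in a common block. The map $Q$ goes from the set of non-crossing partitions of $[2N]$ into blocks of even size to the set of non-crossing partitions of $[2N]$ into pairs: each block $\{k_1,\dots,k_{2p}\}$ of $\pi$ with $1\leq k_1<\dots<k_{2p}\leq2N$ is replaced by the $p$ blocks $\{k_1,k_2\},\dots,\{k_{2p-1},k_{2p}\}$ of $Q(\pi)$. *)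

(* Defs.v *)
(* The set {1, ..., n} is represented by 'I_n = {0, ..., n-1}; only the order
   matters, so the shift by one is harmless. *)
From mathcomp Require Import all_boot.
Set Implicit Arguments.
Unset Strict Implicit.
Unset Printing Implicit Defensive.

Section NonCrossing.
Variable n : nat.
Implicit Types (P : {set {set 'I_n}}) (A B : {set 'I_n}).

Definition noncrossing P : bool :=
  [forall A in P, forall B in P, (A != B) ==>
     ~~ [exists a in A, exists b in B, exists c in A, exists d in B,
           [&& a < b, b < c & c < d]]].

Definition nc_partition P : bool :=
  partition P [set: 'I_n] && noncrossing P.

Definition nc_even P : bool :=
  nc_partition P && [forall B in P, ~~ odd #|B|].

Definition nc_pairing P : bool :=
  nc_partition P && [forall B in P, #|B| == 2].

Definition is_interval A : Prop :=
  forall x y z : 'I_n, x \in A -> z \in A -> x <= y -> y <= z -> y \in A.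

(* Non-emptiness and disjointness make the k intervals pairwise distinct. The
   numbering of the intervals need not follow their order in 'I_n. *)
Definition interval_division k (S : 'I_k -> {set 'I_n}) : Prop :=
  [/\ forall i, is_interval (S i),
      forall i, S i != set0,
      forall i j, i != j -> [disjoint S i & S j]
    & \bigcup_i S i = [set: 'I_n]].

Definition separates k (S : 'I_k -> {set 'I_n}) P : bool :=
  [forall i, forall x in S i, forall y in S i, (x != y) ==>
     [forall B in P, ~~ ((x \in B) && (y \in B))]].

Fixpoint pair_up (s : seq 'I_n) : seq {set 'I_n} :=
  if s is x :: y :: s' then [set x; y] :: pair_up s' else [::].

(* [enum B] lists the elements of B in increasing order. Q is total; it is the
   map of interest on partitions satisfying [nc_even]. *)
Definition Q P : {set {set 'I_n}} :=
  \bigcup_(B in P) [set C in pair_up (enum B)].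

End NonCrossing.

(* Main.v *)
Require Import Defs.
From mathcomp Require Import all_boot.
Set Implicit Arguments.
Unset Strict Implicit.
Unset Printing Implicit Defensive.

(** Call a point inner for [pi] when its block contains both a smaller and a
    greater point. Both bounds come from the fact that every interval [S i]
    contains at most one inner point, and that the first and the last interval
    contain none. If [y < y'] were inner points of the same interval, their
    blocks, which meet the interval only in [y] and [y'], would contain a point
    [b] after the interval and a point [a] before it respectively, so that
    [a < y < y' < b] would be a crossing ([interval_index_inner_inj]). Also, a
    block that contains an inner point has points on both sides of its interval
    ([inner_outside]). Hence there are at most [k - 2] inner points.

    If [Q pi = sigma], the two points of a pair of [sigma] are neighbours in a
    block of [pi]. In a block that is not a pair, a point that is not inner is
    therefore the partner in [sigma] of an inner point ([nonpair_inner]), which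
    bounds the number of points in such blocks by [2 * (k - 2)].

    For the number of partitions, call a point a closer or an opener according
    to whether it is the greater or the smaller point of its pair in [sigma].
    An inner closer is the last closer of its interval, and an inner opener the
    first opener ([inner_closer_last], [inner_opener_first]). So the set of
    inner points is known once one knows which of the [k - 2] intermediate
    intervals contain an inner closer and which contain an inner opener: this
    leaves [2 ^ (k - 2) * 2 ^ (k - 2)] possibilities. Finally [pi] is determined
    by [sigma] and its inner points ([eq_of_inner]): the successor of an opener
    is its partner, and the successors of the inner closers form a non-crossing
    matching with the inner openers, each closer being matched to its right;
    such a matching is unique. *)

(** * Blocks of a partition of an ordered set *)

Section Blocks.
Variable n : nat.
Implicit Types (P : {set {set 'I_n}}) (a b u v w x y z : 'I_n).

(** Throughout, two points lie in a common block of [P] when they have the same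
    [pblock]. *)
Lemma mem_pblockE P x y :
  partition P [set: 'I_n] -> (y \in pblock P x) = (pblock P x == pblock P y).
Proof.
by case/and3P=> /eqP covP tiP _; rewrite eq_pblock // covP inE.
Qed.

Lemma pblock_in P x : partition P [set: 'I_n] -> pblock P x \in P.
Proof. by case/and3P=> /eqP covP _ _; rewrite pblock_mem // covP inE. Qed.

Lemma eq_pblock_of_mem P B x y :
  partition P [set: 'I_n] -> B \in P -> x \in B -> y \in B ->
  pblock P x = pblock P y.
Proof.
by case/and3P=> _ tiP _ BP xB yB; rewrite !(def_pblock tiP BP).
Qed.

Lemma eq_partition P P' :
  partition P [set: 'I_n] -> partition P' [set: 'I_n] ->
  (forall x y, pblock P x = pblock P y <-> pblock P' x = pblock P' y) ->
  P = P'.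
Proof.
move=> hP hP' h.
have pbE x : pblock P x = pblock P' x.
  by apply/setP=> y; rewrite !mem_pblockE //; apply/eqP/eqP=> /h.
have sub P1 P2 : partition P1 [set: 'I_n] -> partition P2 [set: 'I_n] ->
    pblock P1 =1 pblock P2 -> P1 \subset P2.
  move=> h1 h2 e; apply/subsetP=> B BP; case/and3P: (h1) => _ ti n0.
  have /set0Pn [x xB] : B != set0 by apply: contraNneq n0 => <-.
  by rewrite -(def_pblock ti BP xB) e pblock_in.
by apply/eqP; rewrite eqEsubset !sub // => x; rewrite pbE.
Qed.

Lemma noncrossing_pblock P (a b c d : 'I_n) :
  nc_partition P -> a < b -> b < c -> c < d ->
  pblock P a = pblock P c -> pblock P b = pblock P d ->
  pblock P a = pblock P b.
Proof.
case/andP=> hP /forall_inP nc ab bc cd eac ebd.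
apply/eqP; apply: contraT => neq.
have /forall_inP/(_ _ (pblock_in b hP)) := nc _ (pblock_in a hP).
rewrite neq /= => /negP[].
apply/exists_inP; exists a; first by rewrite mem_pblockE.
apply/exists_inP; exists b; first by rewrite mem_pblockE.
apply/exists_inP; exists c; first by rewrite mem_pblockE ?eac.
apply/exists_inP; exists d; first by rewrite mem_pblockE ?ebd.
by rewrite ab bc.
Qed.

Lemma separates_pblock k (S : 'I_k -> {set 'I_n}) P i x y :
  partition P [set: 'I_n] -> separates S P -> x \in S i -> y \in S i ->
  pblock P x = pblock P y -> x = y.
Proof.
move=> hP /forallP/(_ i)/forall_inP h xS yS e.
apply/eqP; apply: contraT => neq.
have /forall_inP/(_ _ yS) := h _ xS.
rewrite neq /= => /forall_inP/(_ _ (pblock_in x hP)).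
by rewrite !mem_pblockE // e !eqxx.
Qed.

(** [y] is the successor of [x] in its block of [P]. *)
Definition adjacent P x y : bool :=
  [&& x < y, pblock P x == pblock P y
    & [forall z : 'I_n, (x < z < y) ==> (pblock P z != pblock P x)]].

(** [x] is neither the least nor the greatest element of its block. *)
Definition inner P x : bool :=
  [exists a : 'I_n, (a < x) && (pblock P a == pblock P x)] &&
  [exists b : 'I_n, (x < b) && (pblock P b == pblock P x)].

Lemma adjacentP P x y :
  reflect [/\ x < y, pblock P x = pblock P y
            & forall z, x < z -> z < y -> pblock P z <> pblock P x]
          (adjacent P x y).
Proof.
apply: (iffP and3P) => [[xy /eqP e /forallP h]|[xy e h]]; split=> //.
- by move=> z xz zy; have := h z; rewrite xz zy /= => /eqP.
- exact/eqP.
- by apply/forallP=> z; apply/implyP=> /andP[xz zy]; apply/eqP/h.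
Qed.

Lemma innerP P x :
  reflect (exists a b, [/\ a < x, x < b, pblock P a = pblock P x
                         & pblock P b = pblock P x])
          (inner P x).
Proof.
apply: (iffP andP).
  case=> /existsP[a /andP[ax /eqP ea]] /existsP[b /andP[xb /eqP eb]].
  by exists a, b.
case=> a [b [ax xb ea eb]]; split; apply/existsP.
  by exists a; rewrite ax ea eqxx.
by exists b; rewrite xb eb eqxx.
Qed.

Lemma adjacent_fun P x y y' : adjacent P x y -> adjacent P x y' -> y = y'.
Proof.
case/adjacentP=> xy e h /adjacentP[xy' e' h'].
case: (ltngtP y y') => [lt|lt|/val_inj //].
  by case: (h' _ xy lt).
by case: (h _ xy' lt).
Qed.

Lemma adjacent_inj P x x' y : adjacent P x y -> adjacent P x' y -> x = x'.
Proof.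
case/adjacentP=> xy e h /adjacentP[xy' e' h'].
case: (ltngtP x x') => [lt|lt|/val_inj //].
  by case: (h _ lt xy'); rewrite e e'.
by case: (h' _ lt xy); rewrite e e'.
Qed.

Lemma adjacent_ex P x b :
  x < b -> pblock P b = pblock P x -> exists2 y, adjacent P x y & y <= b.
Proof.
move=> xb eb.
pose C := [pred z : 'I_n | (x < z) && (pblock P z == pblock P x)].
have Cb : C b by rewrite /= xb eb eqxx.
case: (@arg_minnP _ b C (fun z => z : nat) Cb) => y /andP[xy /eqP ey] ymin.
exists y; last exact: ymin.
apply/adjacentP; split=> // z xz zy ez.
have := ymin z; rewrite /= xz ez eqxx leqNgt zy.
by move/(_ isT).
Qed.

Lemma adjacent_ex_pred P a x :
  a < x -> pblock P a = pblock P x -> exists y, adjacent P y x.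
Proof.
move=> ax ea.
pose C := [pred z : 'I_n | (z < x) && (pblock P z == pblock P x)].
have Ca : C a by rewrite /= ax ea eqxx.
case: (@arg_maxnP _ a C (fun z => z : nat) Ca) => y /andP[yx /eqP ey] ymax.
exists y; apply/adjacentP; split=> // z yz zx ez.
have := ymax z; rewrite /= zx ez ey eqxx => /(_ isT).
by rewrite leqNgt yz.
Qed.

(** The blocks of [P] are the classes of the equivalence relation generated by
    adjacency in [P]. *)
Lemma adjacent_connect P P' x y :
  (forall u v, adjacent P u v -> pblock P' u = pblock P' v) ->
  pblock P x = pblock P y -> pblock P' x = pblock P' y.
Proof.
move=> h.
wlog lt : x y / x <= y => [hw e|].
  by case/orP: (leq_total x y) => [/hw|/hw/(_ (esym e))]; auto.
move: {2}(y - x) (leqnn (y - x)) => m.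
elim: m x lt => [|m IH] x lt le e.
  suff -> : x = y by [].
  by apply/val_inj/eqP; rewrite eqn_leq lt /= -subn_eq0 -leqn0.
move: lt; rewrite leq_eqVlt => /orP[/eqP/val_inj -> //|lt].
have [z az zy] := adjacent_ex lt (esym e).
rewrite (h _ _ az); case/adjacentP: az => xz ez _.
apply: IH => //; last by rewrite -ez.
rewrite -ltnS; apply: leq_trans le.
by rewrite ltn_sub2l.
Qed.

(** * The pairing [Q P] *)

Lemma pair_up_adjacent (s : seq 'I_n) C :
  sorted (fun x y : 'I_n => x < y) s -> C \in pair_up s ->
  exists x y, [/\ C = [set x; y], x \in s, y \in s, x < y
    & forall z, z \in s -> x < z -> z < y -> False].
Proof.
have tr : transitive (fun x y : 'I_n => x < y).
  by move=> y x z; apply: ltn_trans.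
have [m] := ubnP (size s); elim: m s => // m IH [|x [|y s]] //= sz.
move=> /andP[xy pth]; rewrite inE => /predU1P[->|Cs].
  exists x, y; split=> //; rewrite ?inE ?eqxx ?orbT // => z.
  rewrite !inE => /or3P[/eqP->|/eqP->|zs]; rewrite ?ltnn // => _ zy.
  have /allP/(_ _ zs) := order_path_min tr pth.
  by move=> yz; have := ltn_trans yz zy; rewrite ltnn.
have [|a [b [-> sa sb ab hab]]] := IH s _ (path_sorted pth) Cs.
  by rewrite -ltnS; apply: ltnW.
exists a, b; split=> //; rewrite ?inE ?sa ?sb ?orbT // => z.
have /allP/(_ _ sa) ya := order_path_min tr pth.
rewrite !inE => /or3P[/eqP->|/eqP->|zs] az zb; last exact: (hab z).
- by have := ltn_trans (ltn_trans az xy) ya; rewrite ltnn.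
- by have := ltn_trans az ya; rewrite ltnn.
Qed.

Lemma sorted_enum_set (B : {set 'I_n}) :
  sorted (fun x y : 'I_n => x < y) (enum B).
Proof.
rewrite {1}/enum_mem; apply: sorted_filter.
  by move=> y x z; apply: ltn_trans.
by have := iota_ltn_sorted 0 n; rewrite -val_enum_ord sorted_map enumT.
Qed.

(** The blocks of [Q P] join neighbouring elements of the blocks of [P]. *)
Lemma Q_adjacent P x y :
  partition P [set: 'I_n] -> [set x; y] \in Q P -> x < y -> adjacent P x y.
Proof.
move=> hP /bigcupP[B BP].
rewrite inE => /(pair_up_adjacent (sorted_enum_set B)).
case=> a [b [eC]]; rewrite !mem_enum => aB bB ab hab xy.
have [ex ey] : x = a /\ y = b.
  have : x \in [set a; b] by rewrite -eC !inE eqxx.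
  have : y \in [set a; b] by rewrite -eC !inE eqxx orbT.
  rewrite !inE => /orP[]/eqP ey /orP[]/eqP ex; subst => //.
  - by rewrite ltnn in xy.
  - by have := ltn_trans ab xy; rewrite ltnn.
  - by rewrite ltnn in xy.
subst a b; apply/adjacentP; split=> //.
  exact: eq_pblock_of_mem BP _ _.
move=> z xz zy ez; apply: (hab z) => //.
case/and3P: (hP) => _ ti _.
by rewrite mem_enum -(def_pblock ti BP aB) mem_pblockE // ez.
Qed.

End Blocks.

(** * Partitions above a given pairing *)

Section Pairing.
Variables (n : nat) (sigma : {set {set 'I_n}}).
Hypothesis sigmaP : nc_pairing sigma.
Implicit Types (P : {set {set 'I_n}}) (x y z : 'I_n).

(** The element paired with [x]; the default value [x] is never used when
    [sigma] is a pairing. *)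
Definition partner x : 'I_n :=
  odflt x [pick y in pblock sigma x | y != x].

Let sigma_part : partition sigma [set: 'I_n].
Proof. by case/andP: sigmaP => /andP[]. Qed.

Lemma partnerP x :
  partner x != x /\ pblock sigma x = [set x; partner x].
Proof.
case/andP: sigmaP => _ /forall_inP/(_ _ (pblock_in x sigma_part)) c2.
have xin : x \in pblock sigma x by rewrite mem_pblockE.
rewrite /partner; case: pickP => [y /andP[yin yx]|none] /=.
  split=> //; apply/esym/eqP; rewrite eqEcard (eqP c2) cards2 eq_sym yx andbT.
  by apply/subsetP=> z; rewrite !inE => /orP[]/eqP->.
move: c2; rewrite (cardsD1 x) xin /= eqSS => /eqP c1.
have /card_gt0P[y] : 0 < #|pblock sigma x :\ x| by rewrite c1.
by rewrite !inE andbC none.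
Qed.

Lemma partner_neq x : partner x != x. Proof. by case: (partnerP x). Qed.

Lemma pair_in x : [set x; partner x] \in sigma.
Proof. by case: (partnerP x) => _ <-; apply: pblock_in. Qed.

Lemma partner_pblock x : pblock sigma (partner x) = pblock sigma x.
Proof.
apply/esym/eqP; rewrite -mem_pblockE //.
by case: (partnerP x) => _ ->; rewrite !inE eqxx orbT.
Qed.

Lemma partnerK x : partner (partner x) = x.
Proof.
have : x \in pblock sigma (partner x) by rewrite mem_pblockE // partner_pblock.
case: (partnerP (partner x)) => _ ->.
rewrite !inE eq_sym (negPf (partner_neq x)) /=.
by move/eqP.
Qed.

Lemma partner_ltNgt x : (partner x < x) = ~~ (x < partner x).
Proof.
rewrite -leqNgt [in RHS]leq_eqVlt.
by have := partner_neq x; rewrite -val_eqE => /negPf ->.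
Qed.

Section Above.
Variable P : {set {set 'I_n}}.
Hypotheses (ncP : nc_partition P) (QP : Q P = sigma).

Let partP : partition P [set: 'I_n]. Proof. by case/andP: ncP. Qed.

Lemma adjacent_partner x : x < partner x -> adjacent P x (partner x).
Proof. by move=> lt; apply: Q_adjacent; rewrite // QP pair_in. Qed.

Lemma partner_adjacent x : partner x < x -> adjacent P (partner x) x.
Proof.
by move=> lt; have := @adjacent_partner (partner x); rewrite partnerK; apply.
Qed.

Lemma pblock_partner x : pblock P (partner x) = pblock P x.
Proof.
case: (ltnP x (partner x)) => [/adjacent_partner/adjacentP[]//|].
by rewrite leqNgt -partner_ltNgt => /partner_adjacent/adjacentP[].
Qed.

(** A link between consecutive pairs of a block leads from the greater element
    of a pair to the smaller element of the next one. *)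
Lemma adjacent_closer_opener x y :
  partner x < x -> adjacent P x y -> y < partner y.
Proof.
move=> cx axy; apply: contraT; rewrite -partner_ltNgt => cy.
have e := adjacent_inj axy (partner_adjacent cy).
by move: cx; rewrite e partnerK ltnNge (ltnW cy).
Qed.

Lemma nonpair_inner x :
  #|pblock P x| != 2 -> inner P x || inner P (partner x).
Proof.
move=> c2.
have [z zx [zp ez]] :
    exists2 z, z != x & z != partner x /\ pblock P z = pblock P x.
  have sub : [set x; partner x] \subset pblock P x.
    apply/subsetP=> z; rewrite !inE mem_pblockE // => /orP[]/eqP-> //.
    by rewrite pblock_partner.
  have [z] : exists z, z \in pblock P x :\: [set x; partner x].
    apply/set0Pn; apply: contra c2; rewrite setD_eq0 => sub'.
    have -> : pblock P x = [set x; partner x].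
      by apply/eqP; rewrite eqEsubset sub' sub.
    by rewrite cards2 [x == _]eq_sym partner_neq.
  rewrite !inE negb_or mem_pblockE // => /andP[/andP[zx zp] /eqP ->].
  by exists z.
(* The claim is symmetric in [x] and [partner x], so let [x] be the smaller
   element of its pair. *)
wlog ox : x {c2} zx zp ez / x < partner x => [hw|].
  case: (boolP (x < partner x)) => [|]; first exact: hw.
  rewrite -partner_ltNgt => cx; rewrite orbC.
  by have := hw (partner x); rewrite partnerK pblock_partner; apply.
have /adjacentP[_ exp nob] := adjacent_partner ox.
case: (ltngtP z x) => [lt|gt|/val_inj e]; last by rewrite e eqxx in zx.
  by apply/orP; left; apply/innerP; exists z, (partner x).
apply/orP; right; apply/innerP; exists x, z; split=> //; last by rewrite ez.
rewrite ltnNge leq_eqVlt negb_or val_eqE zp /=.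
by apply/negP=> lt; apply: (nob z).
Qed.

End Above.
End Pairing.

(** * A partition is determined by its pairing and its inner points *)

Section Unique.
Variables (n : nat) (sigma : {set {set 'I_n}}).
Hypothesis sigmaP : nc_pairing sigma.
Implicit Types (P : {set {set 'I_n}}) (x y z : 'I_n).

(** The crucial step, for the greatest closer [x] at which the successors could
    differ. If [y < y'], the opener [y] is inner in [P], hence also in [P'],
    where it has a predecessor [w]. If [w < x], then the links from [w] to [y]
    and from [x] to [y'] cross in [P']. If [w > x], then [w] is another
    predecessor of [y] in [P], as [P] and [P'] have the same links beyond
    [x]. *)
Lemma adjacent_step P P' x y y' :
  nc_partition P -> nc_partition P' -> Q P = sigma -> Q P' = sigma ->
  inner P =1 inner P' ->
  (forall u v : 'I_n, x < u -> adjacent P u v = adjacent P' u v) ->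
  partner sigma x < x -> adjacent P x y -> adjacent P' x y' -> y' <= y.
Proof.
move=> nP nP' QP QP' eI IH cx axy axy'; rewrite leqNgt; apply/negP=> lt.
have oy := adjacent_closer_opener sigmaP nP QP cx axy.
have iy : inner P' y.
  rewrite -eI; apply/innerP; exists x, (partner sigma y).
  case/adjacentP: axy => xy e _; split=> //.
  exact: pblock_partner.
case/innerP: iy => a [_ [ay _ ea _]].
have [w awy] := adjacent_ex_pred ay ea.
case: (ltngtP w x) => [wx|xw|/val_inj ewx].
- case/adjacentP: awy => wy ew nob.
  case/adjacentP: axy => xy _ _; case/adjacentP: axy' => _ ex _.
  by apply: (nob x) => //; rewrite (noncrossing_pblock nP' wx xy lt ew ex).
- have {}awy : adjacent P w y by rewrite IH.
  by rewrite (adjacent_inj awy axy) ltnn in xw.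
- rewrite ewx in awy.
  by rewrite (adjacent_fun awy axy') ltnn in lt.
Qed.

(** The two partitions have the same adjacent pairs: the successor of an opener
    is its partner, a closer has a successor exactly when it is inner, and
    [adjacent_step], used in both directions, identifies these successors. *)
Lemma eq_of_inner P P' :
  nc_partition P -> nc_partition P' -> Q P = sigma -> Q P' = sigma ->
  inner P =1 inner P' -> P = P'.
Proof.
move=> nP nP' QP QP' eI.
(* Descending induction on [x]. *)
have eA x y : adjacent P x y = adjacent P' x y.
  move: {2}(n - x) (leqnn (n - x)) => m.
  elim: m x y => [|m IHm] x y le.
    by move: le (ltn_ord x); rewrite leqn0 subn_eq0 ltnNge => ->.
  have IH (u v : 'I_n) : x < u -> adjacent P u v = adjacent P' u v.
    move=> xu; apply: IHm; rewrite -ltnS; apply: leq_trans le.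
    by rewrite ltn_sub2l.
  have half P1 P2 : nc_partition P1 -> nc_partition P2 ->
      Q P1 = sigma -> Q P2 = sigma -> inner P1 =1 inner P2 ->
      (forall u v : 'I_n, x < u -> adjacent P1 u v = adjacent P2 u v) ->
      adjacent P1 x y -> adjacent P2 x y.
    move=> n1 n2 Q1 Q2 e12 IH12 axy.
    case: (boolP (x < partner sigma x)) => [ox|].
      have a1 := adjacent_partner sigmaP n1 Q1 ox.
      by rewrite (adjacent_fun axy a1) adjacent_partner.
    rewrite -(partner_ltNgt sigmaP) => cx.
    have : inner P2 x.
      rewrite -e12; apply/innerP; exists (partner sigma x), y.
      case/adjacentP: axy => xy e _; split=> //.
      exact: pblock_partner.
    case/innerP=> _ [b [_ xb _ eb]].
    have [y' axy' _] := adjacent_ex xb eb.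
    suff -> : y = y' by [].
    apply/val_inj/eqP; rewrite eqn_leq; apply/andP; split.
      apply: (@adjacent_step P2 P1 x) => // u v xu.
      by rewrite IH12.
    exact: (@adjacent_step P1 P2 x).
  by apply/idP/idP; apply: half => // u v xu; rewrite IH.
have [pP pP'] : partition P [set: 'I_n] /\ partition P' [set: 'I_n].
  by case/andP: nP; case/andP: nP'.
apply: eq_partition => // x y; split; apply: adjacent_connect => u v.
  by rewrite eA => /adjacentP[].
by rewrite -eA => /adjacentP[].
Qed.

End Unique.

(** * Interval divisions and the two bounds *)

Section Intervals.
Variables (n k : nat) (S : 'I_k -> {set 'I_n}) (sigma : {set {set 'I_n}}).
Hypotheses (divS : interval_division S) (sigmaP : nc_pairing sigma).
Hypothesis (sepsigma : separates S sigma).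
Implicit Types (P : {set {set 'I_n}}) (x y z : 'I_n).

Lemma interval_index_ex x : exists i, x \in S i.
Proof.
case: divS => _ _ _ covS; have : x \in [set: 'I_n] by rewrite inE.
by rewrite -covS => /bigcupP[i _ xi]; exists i.
Qed.

(** The index of the interval that contains [x]. *)
Definition interval_index x : 'I_k := xchoose (interval_index_ex x).

Lemma in_interval_index x : x \in S (interval_index x).
Proof. exact: (xchooseP (interval_index_ex x)). Qed.

Lemma interval_indexE x i : x \in S i -> interval_index x = i.
Proof.
case: divS => _ _ dis _ xi; apply/eqP; apply: contraT => /dis.
rewrite disjoint_subset => /subsetP/(_ _ (in_interval_index x)).
by rewrite !inE xi.
Qed.

Lemma interval_index_between x y z :
  interval_index x = interval_index z -> x <= y -> y <= z ->
  interval_index y = interval_index x.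
Proof.
case: divS => itv _ _ _ e xy yz; apply: interval_indexE.
apply: (itv _ x y z) => //; first exact: in_interval_index.
by rewrite e in_interval_index.
Qed.

Lemma interval_index_sep P x y :
  partition P [set: 'I_n] -> separates S P ->
  interval_index x = interval_index y -> pblock P x = pblock P y -> x = y.
Proof.
move=> hP sep e; apply: (separates_pblock hP sep (in_interval_index x)).
by rewrite e in_interval_index.
Qed.

(** A block meets an interval at most once, so the points of the block of [y]
    that surround [y] surround the whole interval of [y]. *)
Lemma inner_outside P y :
  partition P [set: 'I_n] -> separates S P -> inner P y ->
  exists a b, [/\ pblock P a = pblock P y, pblock P b = pblock P y,
    forall x, interval_index x = interval_index y -> a < x
    & forall x, interval_index x = interval_index y -> x < b].
Proof.
move=> hP sep /innerP[a [b [ay yb ea eb]]]; exists a, b; split=> // x e.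
  rewrite ltnNge; apply/negP=> xa.
  have e1 : interval_index a = interval_index y.
    by rewrite -e; apply: (interval_index_between e) => //; apply: ltnW.
  by move: ay; rewrite (interval_index_sep hP sep e1 ea) ltnn.
rewrite ltnNge; apply/negP=> bx.
have e1 : interval_index b = interval_index y.
  by apply: (interval_index_between (esym e)) => //; apply: ltnW.
by move: yb; rewrite (interval_index_sep hP sep e1 eb) ltnn.
Qed.

Lemma interval_index_inner_inj P :
  nc_partition P -> separates S P -> {in inner P &, injective interval_index}.
Proof.
move=> nP sep.
have hP : partition P [set: 'I_n] by case/andP: nP.
move=> y y' iy iy' e.
wlog lt : y y' iy iy' e / y < y' => [hw|].
  case: (ltngtP y y') => [lt|gt|/val_inj //]; first exact: hw.
  by apply/esym/hw.
have [_ [b [_ eb _ hb]]] := inner_outside hP sep iy.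
have [a [_ [ea _ ha _]]] := inner_outside hP sep iy'.
have cr := noncrossing_pblock nP (ha _ e) lt (hb _ (esym e)) ea (esym eb).
by apply: (interval_index_sep hP sep e); rewrite -cr.
Qed.

Let sigma_part : partition sigma [set: 'I_n].
Proof. by case/andP: sigmaP => /andP[]. Qed.

Lemma partner_index x : interval_index (partner sigma x) <> interval_index x.
Proof.
move=> e; have ep := partner_pblock sigmaP x; have := partner_neq sigmaP x.
by rewrite (interval_index_sep sigma_part sepsigma e ep) eqxx.
Qed.

(** If a closer [y'] came after [y], the pair of [y'], which starts before the
    interval, would cross the block of [y], which continues after it. *)
Lemma inner_closer_last P y y' :
  nc_partition P -> separates S P -> Q P = sigma -> inner P y ->
  partner sigma y' < y' -> interval_index y = interval_index y' -> y' <= y.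
Proof.
move=> nP sep QP iy cy' e; rewrite leqNgt; apply/negP=> lt.
have hP : partition P [set: 'I_n] by case/andP: nP.
have [_ [b [_ eb _ hb]]] := inner_outside hP sep iy.
have wy : partner sigma y' < y.
  rewrite ltnNge; apply/negP=> yw; apply: (@partner_index y').
  rewrite -e; apply: (interval_index_between e yw); exact: ltnW.
have ew := pblock_partner sigmaP nP QP y'.
have cr := noncrossing_pblock nP wy lt (hb _ (esym e)) ew (esym eb).
by move: lt; rewrite (interval_index_sep hP sep e (etrans (esym cr) ew)) ltnn.
Qed.

Lemma inner_opener_first P y y' :
  nc_partition P -> separates S P -> Q P = sigma -> inner P y ->
  y' < partner sigma y' -> interval_index y = interval_index y' -> y <= y'.
Proof.
move=> nP sep QP iy oy' e; rewrite leqNgt; apply/negP=> lt.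
have hP : partition P [set: 'I_n] by case/andP: nP.
have [a [_ [ea _ ha _]]] := inner_outside hP sep iy.
have yw : y < partner sigma y'.
  rewrite ltnNge; apply/negP=> wy; apply: (@partner_index y').
  by apply: (interval_index_between (esym e) _ wy); exact: ltnW.
have ew := pblock_partner sigmaP nP QP y'.
have cr := noncrossing_pblock nP (ha _ (esym e)) lt yw ea (esym ew).
by move: lt; rewrite (interval_index_sep hP sep e (etrans (esym ea) cr)) ltnn.
Qed.

(** The inner points of [P] that are the greater, respectively the smaller,
    element of their pair in [sigma]. *)
Definition inner_closers P := [set x | inner P x & partner sigma x < x].
Definition inner_openers P := [set x | inner P x & x < partner sigma x].

(** The inner closers and the inner openers are determined by the intervals in
    which they lie, and they determine the partition. *)
Lemma eq_of_codes P P' :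
  nc_partition P -> nc_partition P' -> separates S P -> separates S P' ->
  Q P = sigma -> Q P' = sigma ->
  interval_index @: inner_closers P = interval_index @: inner_closers P' ->
  interval_index @: inner_openers P = interval_index @: inner_openers P' ->
  P = P'.
Proof.
move=> nP nP' sep sep' QP QP' ec eo.
have half P1 P2 x : nc_partition P1 -> nc_partition P2 ->
    separates S P1 -> separates S P2 -> Q P1 = sigma -> Q P2 = sigma ->
    interval_index @: inner_closers P1 = interval_index @: inner_closers P2 ->
    interval_index @: inner_openers P1 = interval_index @: inner_openers P2 ->
    inner P1 x -> inner P2 x.
  move=> n1 n2 s1 s2 Q1 Q2 e1 e2 ix.
  case: (boolP (x < partner sigma x)) => [ox|].
    have : interval_index x \in interval_index @: inner_openers P2.
      by rewrite -e2; apply: imset_f; rewrite inE ix.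
    case/imsetP=> y; rewrite inE => /andP[iy oy] e.
    suff -> : x = y by [].
    apply/val_inj/eqP; rewrite eqn_leq.
    by rewrite (inner_opener_first n1) // (inner_opener_first n2).
  rewrite -(partner_ltNgt sigmaP) => cx.
  have : interval_index x \in interval_index @: inner_closers P2.
    by rewrite -e1; apply: imset_f; rewrite inE ix.
  case/imsetP=> y; rewrite inE => /andP[iy cy] e.
  suff -> : x = y by [].
  apply/val_inj/eqP; rewrite eqn_leq.
  by rewrite (inner_closer_last n2) // (inner_closer_last n1).
apply: (eq_of_inner sigmaP) => // x.
by apply/idP/idP; apply: half.
Qed.

(** [K] is the set of the intervals that contain neither the least nor the
    greatest point; these two points lie in distinct intervals because an
    interval containing both would be everything, and contain a pair of
    [sigma]. *)
Lemma inner_intervals : 0 < n ->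
  exists2 K : {set 'I_k}, #|K| = k - 2 &
    forall P x, partition P [set: 'I_n] -> separates S P -> inner P x ->
      interval_index x \in K.
Proof.
move=> n0; have ln : n.-1 < n by rewrite prednK.
pose o := Ordinal n0; pose l := Ordinal ln.
have ge0 (x : 'I_n) : o <= x by [].
have leL (x : 'I_n) : x <= l by rewrite -ltnS /= prednK.
have neq : interval_index o != interval_index l.
  apply/eqP=> e; apply: (@partner_index o).
  exact: (interval_index_between e (ge0 _) (leL _)).
exists (~: [set interval_index o; interval_index l]).
  by rewrite cardsCs setCK cards2 neq card_ord.
move=> P x hP sep ix.
have [a [b [_ _ ha hb]]] := inner_outside hP sep ix.
rewrite !inE negb_or; apply/andP; split; apply/eqP=> e.
  by have := ha _ (esym e); rewrite ltn0.
by have := hb _ (esym e); rewrite ltnNge leL.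
Qed.

Lemma card_nonpair_le P :
  0 < n -> nc_partition P -> separates S P -> Q P = sigma ->
  #|[set x | #|pblock P x| != 2]| <= 2 * k - 4.
Proof.
move=> n0 nP sep QP; have hP : partition P [set: 'I_n] by case/andP: nP.
pose M := [set x | inner P x].
have cM : #|M| <= k - 2.
  have [K <- hK] := inner_intervals n0.
  rewrite -(card_in_imset (f := interval_index)).
    by apply/subset_leq_card/subsetP=> _ /imsetP[x xM ->];
      apply: (hK P) => //; rewrite inE in xM.
  move=> x y; rewrite !inE; exact: interval_index_inner_inj.
have -> : 2 * k - 4 = (k - 2) + (k - 2).
  by rewrite -[4]/(2 * 2) -mulnBr mul2n addnn.
apply: leq_trans (leq_add cM cM).
apply: (@leq_trans #|M :|: partner sigma @: M|).
  apply/subset_leq_card/subsetP=> x; rewrite inE => c2; rewrite in_setU inE.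
  case/orP: (nonpair_inner sigmaP nP QP c2) => [->//|ip].
  by rewrite -(partnerK sigmaP x) imset_f ?orbT // inE.
by rewrite cardsU (leq_trans (leq_subr _ _)) // leq_add2l leq_imset_card.
Qed.

Lemma card_preimage_le : 0 < n ->
  #|[set P | [&& nc_even P, separates S P & Q P == sigma]]| <= 4 ^ (k - 2).
Proof.
move=> n0; have [K cK hK] := inner_intervals n0.
pose code P :=
  (interval_index @: inner_closers P, interval_index @: inner_openers P).
rewrite -(card_in_imset (f := code)).
  have -> : 4 ^ (k - 2) = #|setX (powerset K) (powerset K)|.
    by rewrite cardsX card_powerset cK -expnMn.
  apply/subset_leq_card/subsetP=> C /imsetP[P].
  rewrite inE => /and3P[/andP[/andP[hP _] _] sep _] ->.
  rewrite inE /= !powersetE; apply/andP; split;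
    by apply/subsetP=> _ /imsetP[x xM ->]; apply: (hK P) => //;
      move: xM; rewrite inE => /andP[].
move=> P P'; rewrite !inE => /and3P[/andP[nP _] sep /eqP QP].
case/and3P=> /andP[nP' _] sep' /eqP QP' [e1 e2].
exact: eq_of_codes.
Qed.

End Intervals.

(* The hypotheses force 2 <= k, so the subtractions below are never truncated. *)
Theorem lemma1p14 (N k : nat) (S : 'I_k -> {set 'I_(2 * N)})
    (sigma : {set {set 'I_(2 * N)}})
    (hN : 1 <= N)
    (hS : interval_division S)
    (hsigma : nc_pairing sigma)
    (hsep : separates S sigma) :
  #|[set pi : {set {set 'I_(2 * N)}} |
      [&& nc_even pi, separates S pi & Q pi == sigma]]| <= 4 ^ (k - 2)
  /\
  (forall pi : {set {set 'I_(2 * N)}},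
     nc_even pi -> separates S pi -> Q pi = sigma ->
     #|[set i : 'I_(2 * N) | #|pblock pi i| != 2]| <= 2 * k - 4).
Proof.
have n0 : 0 < 2 * N by rewrite muln_gt0.
split; first exact: card_preimage_le.
move=> pi /andP[nP _] sep QP.
exact: (card_nonpair_le hS hsigma hsep n0 nP sep QP).
Qed.
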